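(* Let $\beta_1,\beta_2>1$ be two different non-integer real numbers. If $\nu_{\beta_1}=\nu_{\beta_2}$ and $\log\beta_1/\log\beta_2\in\mathbb{Q}$, then $$\{\beta_1,\beta_2\}=\left\{\frac{1+\sqrt5}{2},\ \left(\frac{1+\sqrt5}{2}\right)^2\right\}.$$
   Context: For real $\beta>1$, the $\beta$-transformation $T_\beta:[0,1)\to[0,1)$ is $T_\beta(x)=\beta x \pmod 1$, i.e. $T_\beta(x)=\beta x-\lfloor \beta x\rfloor$. The Rényi–Parry measure $\nu_\beta$ is the unique $T_\beta$-invariant Borel probability measure on $[0,1)$ equivalent to Lebesgue measure (existence and uniqueness are due to Rényi). By a theorem of Parry, its density with respect to Lebesgue measure is $\widetilde h_\beta(x)=\frac{1}{K_\beta}\sum_{n\ge 0,\ T_\beta^n(1)>x}\beta^{-n}$ for $x\in[0,1)$, where $T_\beta^0(1):=1$, $T_\beta^1(1):=\beta-\lfloor\beta\rfloor$, $T_\beta^n(1):=T_\beta(T_\beta^{n-1}(1))$ for $n\ge 2$, and $K_\beta=\sum_{n=0}^\infty T_\beta^n(1)\beta^{-n}$. *)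

(* Defs.v *)
From HB Require Import structures.
From mathcomp Require Import all_boot all_order all_algebra.
From mathcomp Require Import all_classical all_reals all_analysis.

Set Implicit Arguments.
Unset Strict Implicit.
Unset Printing Implicit Defensive.

Import Order.TTheory GRing.Theory Num.Theory.
Import numFieldNormedType.Exports.

Local Open Scope classical_set_scope.
Local Open Scope ring_scope.

Definition unit_itv (R : realType) : set (measurableTypeR R) :=
  `[0%R, 1%R[%classic.

Lemma measurable_unit_itv (R : realType) : measurable (@unit_itv R).
Proof. exact: measurable_itv. Qed.

Definition beta_transformation (R : realType) (beta x : R) : R :=
  beta * x - (Num.floor (beta * x))%:~R.

(* Borel measures on [0, 1) are represented by Borel measures on R that are
   concentrated on [0, 1). *)
Definition lebesgue01 (R : realType) :
    {measure set (measurableTypeR R) -> \bar R} :=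
  mrestr (@lebesgue_measure R) (@measurable_unit_itv R).

(* nu is a beta_transformation-invariant Borel probability measure on [0, 1)
   equivalent to Lebesgue measure. By a theorem of Renyi, for beta > 1 exactly
   one Borel measure has these properties. *)
Definition is_renyi_parry (R : realType) (beta : R)
    (nu : probability (measurableTypeR R) R) : Prop :=
  [/\ nu (@unit_itv R) = 1%E,
      (forall A : set (measurableTypeR R), measurable A -> A `<=` @unit_itv R ->
        nu (@unit_itv R `&` beta_transformation beta @^-1` A) = nu A),
      nu `<< @lebesgue01 R &
      @lebesgue01 R `<< nu].

(* The values of a measure at non-measurable sets carry no information, so
   equality of Borel measures is equality on measurable sets. *)
Definition eq_borel_measure (R : realType)
    (mu nu : {measure set (measurableTypeR R) -> \bar R}) : Prop :=
  forall A, measurable A -> mu A = nu A.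

(* Main.v *)
Require Import Defs.
From mathcomp Require Import all_boot all_order all_algebra.
From mathcomp Require Import finmap.
From mathcomp Require Import all_classical all_reals all_analysis.
From mathcomp Require Import measurable_realfun zify ring lra.

(* Write [x_n] for the orbit of 1 under the beta-transformation [T], [b] for
   [beta^-1] and [nu] for the Renyi-Parry measure. Parry's formula for the
   density, integrated over [[0, c)], reads
     [(\sum_n b^n x_n) nu([0, c)) = \sum_n b^n min(x_n, c)].
   Let [L_n(t)] be the Lebesgue measure of [[0, t)] intersected with the n-th
   preimage of [[0, c)], so that
     [L_(n+1)(t) = b (floor(beta t) L_n(1) + L_n(T t))].
   The convolution of [L_n(t)] with the weights [b^j x_j] telescopes at [t = 1]
   to the partial sums of the right-hand side of Parry's formula, and the
   recursion then contracts the convolution at any [t] to [t] times their limit.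
   By the pi-lambda theorem and the density of simple functions in L1, this
   passes from Lebesgue measure to [nu], for which invariance makes the
   convolution explicit.

   Second differences in [c] show that two bases with the same measure have the
   same masses [J(y) = \sum_(n | x_n = y) b^n] for [0 < y <= 1], and the same
   total mass outside 0. If both orbits of 1 reach 0, or if both avoid 0, the
   bases are equal. Suppose that the orbit of [beta] reaches 0 and that the orbit
   of the other base [gamma] does not. A point with a single preimage in the
   orbit of [gamma] has [gamma^-1] times the mass of that preimage, and at most
   one point has several preimages. Comparing the masses of [x_1] and [x_2] gives
   [x_2 = 0] and [gamma = beta + 1], hence [beta^2 = q beta + p] with [p] and [q]
   positive integers. Finally [beta^m = (beta + 1)^n] reduces to [0 = 1] modulo
   [p], and then to [0 = 1] or [0 = -1] modulo [q], so that [p = q = 1]. *)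

Set Implicit Arguments.
Unset Strict Implicit.
Unset Printing Implicit Defensive.

Import Order.TTheory GRing.Theory Num.Theory.
Import numFieldNormedType.Exports.

Local Open Scope classical_set_scope.
Local Open Scope ring_scope.

(** * Lebesgue measure of preimages under the beta-transformation *)

(** Uniqueness of Lebesgue measure: [a] times its pushforward under the affine map gives every
    interval []u, v]] its length. *)
Lemma lebesgue_measure_affine_preimage (R : realType) (a c : R)
    (A : set (measurableTypeR R)) : 0 < a -> measurable A ->
  lebesgue_measure ((fun y : measurableTypeR R => a * y - c) @^-1` A)
  = (a^-1%:E * lebesgue_measure A)%E.
Proof.
move=> a0 mA.
have mf : measurable_fun setT
    ((fun y => a * y - c) : measurableTypeR R -> measurableTypeR R).
  by apply: measurable_funB; [exact: mulrl_measurable|exact: measurable_cst].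
pose am := NngNum (ltW a0).
have [M ME] : exists M : {measure set (measurableTypeR R) -> \bar R}, forall B,
    M B = lebesgue_measure ((fun y : measurableTypeR R => a * y - c) @^-1` B).
  by exists (measure_function_pushforward__canonical__measure_function_Measure lebesgue_measure mf).
have mscaleE B : mscale am M B =
    (a%:E * lebesgue_measure ((fun y : measurableTypeR R => (a * y - c)%R) @^-1` B))%E.
  by congr (_ * _)%E; exact: ME.
have key : lebesgue_measure A = mscale am M A.
  apply: lebesgue_measure_unique mA => _ [[u v]] _ <-.
  apply: (etrans _ (esym (mscaleE _))).
  have -> : (fun y : R => a * y - c) @^-1` `]u, v] =
            `](u + c) / a, (v + c) / a]%classic.
    apply/seteqP; split => y /=; rewrite !in_itv /= ltr_pdivrMr// ler_pdivlMr//;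
      by move=> /andP[? ?]; apply/andP; split; lra.
  rewrite !lebesgue_measure_itv /= !lte_fin ltr_pM2r ?invr_gt0// ltrD2r.
  case: ifP => _; last by rewrite mule0.
  rewrite -!EFinD -EFinM; congr EFin; field; exact: lt0r_neq0.
rewrite key [in RHS]mscaleE muleA -EFinM mulVf ?mul1e//; exact: lt0r_neq0.
Qed.

Lemma measurable_beta_transformation (R : realType) (beta : R) (D : set (measurableTypeR R)) :
  measurable D ->
  measurable_fun D (beta_transformation beta : measurableTypeR R -> measurableTypeR R).
Proof.
move=> mD.
apply: measurable_funB; first by apply: measurable_funTS; exact: mulrl_measurable.
apply: measurable_funTS.
apply: (measurableT_comp (f := fun y : R => (Num.floor y)%:~R : R)); last exact: mulrl_measurable.
apply: nondecreasing_measurable => // x y xy.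
by rewrite ler_int le_floor.
Qed.

Lemma beta_transformation_itv (R : realType) (beta y : R) :
  0 <= beta_transformation beta y < 1.
Proof. rewrite /beta_transformation; have := floor_itv (beta * y); lra. Qed.

(** On the branch where the floor is [k] the transformation is affine, and [s <= 1] keeps the
    interval inside that branch. *)
Lemma beta_transformation_slice (R : realType) (beta s : R) (k : nat)
    (A : set R) : 0 < beta -> s <= 1 ->
  `[k%:R / beta, (k%:R + s) / beta[ `&` beta_transformation beta @^-1` A =
  (fun y => beta * y - k%:R) @^-1` (A `&` `[0, s[).
Proof.
move=> b0 s1.
have E y : 0 <= beta * y - k%:R < s -> beta_transformation beta y = beta * y - k%:R.
  move=> H; rewrite /beta_transformation; congr (_ - _).
  rewrite (@floor_def _ _ k%:Z)// intrD -!pmulrn; lra.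
apply/seteqP; split => y /=; rewrite !in_itv /= ler_pdivrMr// ltr_pdivlMr//.
  move=> [/andP[h1 h2] Ay]; rewrite -E; last lra.
  by split => //; rewrite E; lra.
move=> [Ay /andP[h1 h2]]; split; first lra.
by rewrite E //; lra.
Qed.

(** [[0, t)] consists of [floor (beta * t)] full branches, each mapped onto [[0, 1)], and of a last
    piece mapped onto [[0, T t)]; every branch contracts lengths by [beta^-1] backwards. *)
Lemma lebesgue_beta_transformation_preimage (R : realType) (beta t : R)
    (A : set (measurableTypeR R)) : 0 < beta -> 0 <= t -> measurable A ->
  A `<=` @unit_itv R ->
  lebesgue_measure (`[0, t[ `&` beta_transformation beta @^-1` A) =
  (beta^-1%:E * ((Num.floor (beta * t))%:~R%:E * lebesgue_measure A +
    lebesgue_measure (A `&` `[0%R, beta_transformation beta t[)))%E.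
Proof.
move=> b0 t0 mA A1.
have mT D : measurable D -> measurable (D `&` beta_transformation beta @^-1` A).
  by move=> mD; exact: measurable_beta_transformation.
have slice k s : s <= 1 -> lebesgue_measure
   (`[k%:R / beta, (k%:R + s) / beta[ `&` beta_transformation beta @^-1` A) =
   (beta^-1%:E * lebesgue_measure (A `&` `[0%R, s[))%E.
  move=> s1; rewrite beta_transformation_slice//.
  rewrite (lebesgue_measure_affine_preimage k%:R b0)//; exact: measurableI.
have split (u v : R) : 0 <= u <= v -> lebesgue_measure (`[0, v[ `&` beta_transformation beta @^-1` A) =
   (lebesgue_measure (`[0%R, u[ `&` beta_transformation beta @^-1` A) +
    lebesgue_measure (`[u, v[ `&` beta_transformation beta @^-1` A))%E.
  move=> uv; rewrite -measureU; [|exact: mT|exact: mT|].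
    rewrite -setIUl; congr (lebesgue_measure (_ `&` _)).
    by apply/seteqP; split => y /=; rewrite !in_itv /=; [case: (ltP y u) => ?; [left|right]; lra|move=> [?|?]; lra].
  by apply/seteqP; split => y //= [[]]; rewrite !in_itv /= => ? _ [? _]; lra.
have full k : lebesgue_measure (`[0, k%:R / beta[ `&` beta_transformation beta @^-1` A) =
   (beta^-1%:E * (k%:R%:E * lebesgue_measure A))%E.
  elim: k => [|k IH].
    rewrite mul0r set_itv_ge ?set0I ?measure0 ?mul0e ?mule0//.
    by rewrite -leNgt bnd_simp.
  rewrite (split (k%:R/beta)); last first.
    apply/andP; split; first by rewrite divr_ge0// ltW.
    by rewrite ler_pM2r ?invr_gt0// ler_nat.
  rewrite IH; have := slice k 1 (lexx 1); rewrite natr1 => ->.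
  rewrite (setIidl A1) -natr1 EFinD.
  rewrite ge0_muleDl ?lee_fin// mul1e ge0_muleDr ?mule_ge0 ?lee_fin//.
have [k kE] : exists k : nat, Num.floor (beta * t) = k%:Z.
  exists `|Num.floor (beta * t)|%N; rewrite gez0_abs// floor_ge0; exact/mulr_ge0/t0/ltW.
have ht := beta_transformation_itv beta t.
have tE : t = (k%:R + beta_transformation beta t) / beta.
  rewrite /beta_transformation kE -pmulrn; field; exact: lt0r_neq0.
rewrite {1}tE (split (k%:R / beta)); last first.
  apply/andP; split; first by rewrite divr_ge0// ltW.
  by rewrite ler_pM2r ?invr_gt0//; lra.
rewrite full slice; last lra.
rewrite kE -pmulrn -ge0_muleDr//.
by rewrite mule_ge0// lee_fin.
Qed.

(** * Convergence of weighted averages of measures *)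

(** A three-epsilon argument for uniform approximation. The free constant [C] lets error bounds be
    stated without rescaling [e]. *)
Lemma cvgn_approx (R : realType) (u : R^nat) (l C : R) :
  (forall e, 0 < e -> exists (v : R^nat) (l' : R), [/\ v @ \oo --> l',
     forall n, `|u n - v n| <= C * e & `|l - l'| <= C * e]) ->
  u @ \oo --> l.
Proof.
move=> H; apply/cvgrPdist_le => e e0.
have C0 : 0 < `|C| + 1 by rewrite ltr_wpDl.
pose e' := e / (`|C| + 1) / 3.
have e'0 : 0 < e' by rewrite !divr_gt0.
have [v [l' [vl uv ll]]] := H _ e'0.
have Ce : C * e' <= e / 3.
  rewrite /e' [leRHS](_ : _ = (`|C| + 1) * (e / (`|C| + 1) / 3)); last first.
    by field; exact: lt0r_neq0.
  by rewrite ler_wpM2r ?(ltW e'0)//; have := ler_norm C; lra.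
have e3 : 0 < e / 3 by rewrite divr_gt0.
have /cvgrPdist_le/(_ _ e3) := vl.
apply: filterS => n Hn.
have -> : l - u n = (l - l') + (l' - v n) + (v n - u n) by ring.
have := ler_normD (l - l' + (l' - v n)) (v n - u n).
have := ler_normD (l - l') (l' - v n).
have := uv n; rewrite distrC; lra.
Qed.

Section weighted_averages.
Context d (T : measurableType d) (R : realType).
Variables (a : R^nat) (K : R) (E : (set T)^nat).
Hypotheses (a0 : forall n, 0 <= a n) (aK : forall n, \sum_(j < n) a j <= K)
  (mE : forall n, measurable (E n)).

(** A discrete convolution of the weights with the measures of [E k] inside [D]; in the application
    [E k] is the [k]-th preimage of [[0, c)]. *)
Definition weighted_average (mu : set T -> \bar R) (n : nat) (D : set T) : R :=
  \sum_(j < n.+1) a j * fine (mu (E (n - j)%N `&` D)).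

Let fine_measureD (mu : {finite_measure set T -> \bar R}) (A B : set T) :
  measurable A -> measurable B -> B `<=` A ->
  fine (mu (A `\` B)) = fine (mu A) - fine (mu B).
Proof.
move=> mA mB BA; rewrite measureD// ?ltey_eq ?fin_num_measure//.
by rewrite (setIidr BA) fineB// fin_num_measure.
Qed.

Let wavgD (mu : {finite_measure set T -> \bar R}) n (A B : set T) :
  measurable A -> measurable B -> B `<=` A ->
  weighted_average mu n (A `\` B) = weighted_average mu n A - weighted_average mu n B.
Proof.
move=> mA mB BA; rewrite /weighted_average -sumrB; apply: eq_bigr => j _.
rewrite setIDA -mulrBr -fine_measureD; [|exact: measurableI..|exact: setIS].
congr (_ * fine (mu _)); apply/seteqP; split => x /=; first by move=> [[? ?] ?]; split => // -[].
by move=> [[? ?] H]; split => // ?; exact: H.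
Qed.

Let wavg_ge0 (mu : {finite_measure set T -> \bar R}) n (A : set T) :
  0 <= weighted_average mu n A.
Proof. by apply: sumr_ge0 => j _; rewrite mulr_ge0// fine_ge0. Qed.

Let wavg_le (mu : {finite_measure set T -> \bar R}) n (A : set T) : measurable A ->
  weighted_average mu n A <= K * fine (mu A).
Proof.
move=> mA; apply: (@le_trans _ _ (\sum_(j < n.+1) a j * fine (mu A))).
  apply: ler_sum => j _; apply: ler_wpM2l => //.
  apply: fine_le; rewrite ?fin_num_measure//; first exact: measurableI.
  by apply: le_measure; rewrite ?inE//; exact: measurableI.
by rewrite -mulr_suml ler_wpM2r// fine_ge0.
Qed.

(** The weights sum to at most [K], so removing a set of measure [e] changes every average by at
    most [K * e]. This uniformity in [n] carries convergence through increasing unions, as the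
    pi-lambda theorem requires. *)
Lemma weighted_average_cvg_measurable (lam : {finite_measure set T -> \bar R})
    (H : R) (G : set (set T)) :
  setI_closed G -> @measurable _ T = <<s G >> ->
  (forall D, G D \/ D = setT ->
    weighted_average lam n D @[n --> \oo] --> H * fine (lam D)) ->
  forall D, measurable D ->
    weighted_average lam n D @[n --> \oo] --> H * fine (lam D).
Proof.
move=> GI mG GH D; rewrite mG => sD.
suff : <<s G >> `<=` [set D | measurable D /\
    (weighted_average lam n D @[n --> \oo] --> H * fine (lam D))] by move=> /(_ _ sD)[].
have GP X : G X \/ X = setT -> measurable X /\
    (weighted_average lam n X @[n --> \oo] --> H * fine (lam X)).
  move=> GX; split; last exact: GH.
  by case: GX => [GX|->//]; rewrite mG; exact: sub_sigma_algebra.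
apply: lambda_system_subset => //; last by move=> X GX; apply: GP; left.
split => //.
- by apply: GP; right.
- move=> A B BA [mA cA] [mB cB]; split; first exact: measurableD.
  rewrite fine_measureD// mulrBr.
  under eq_fun do rewrite wavgD//.
  exact: cvgB.
move=> F ndF FP.
have mF i : measurable (F i) by have [] := FP i.
have mU : measurable (\bigcup_i F i) by exact: bigcup_measurable.
split => //; apply: (@cvgn_approx _ _ _ (K + `|H|)) => e e0.
have : fine (lam (F n)) @[n --> \oo] --> fine (lam (\bigcup_n F n)).
  by apply: fine_cvg; rewrite fineK ?fin_num_measure//; exact: nondecreasing_cvg_mu.
have FU i : F i `<=` \bigcup_i F i by exact: bigcup_sup.
move=> /cvgrPdist_le/(_ _ e0)[k _ /(_ k (leqnn _))] /= Hk.
have [_ cF] := FP k.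
have K0 : 0 <= K by have := aK 0; rewrite big_ord0.
have {}Hk : fine (lam (\bigcup_i F i `\` F k)) <= e.
  by rewrite fine_measureD//; have := ler_norm (fine (lam (\bigcup_n F n)) - fine (lam (F k))); lra.
exists (fun n => weighted_average lam n (F k)), (H * fine (lam (F k))); split => //.
  move=> n; rewrite -wavgD// ger0_norm//.
  apply: (le_trans (wavg_le _ _ _)); first exact: measurableD.
  apply: ler_pM => //; first by rewrite fine_ge0.
  by rewrite lerDl.
rewrite -mulrBr -fine_measureD// normrM.
rewrite [X in _ * X]ger0_norm ?fine_ge0//.
by apply: ler_pM => //; rewrite ?fine_ge0// lerDr.
Qed.

Import HBSimple.

Let integral_sfun (lam : {finite_measure set T -> \bar R}) (g : {sfun T >-> R}) (D : set T) :
  measurable D -> (\int[lam]_(x in D) (g x)%:E)%E =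
    (\sum_(c <- fset_set (range g)) c * fine (lam (D `&` g @^-1` [set c])))%:E.
Proof.
move=> mD.
have mg c : measurable (g @^-1` [set c]) by exact: measurable_funPTI.
under eq_integral => x _ do
  rewrite fimfunE fsbig_finite//= -sumEFin.
have int1 c : lam.-integrable D (fun x => (\1_(g @^-1` [set c]) x)%:E).
  apply: (integrableS measurableT) => //; apply/integrable_indic => //.
rewrite integral_sum//; last first.
  by move=> c; under eq_fun do rewrite EFinM; exact: integrableZl.
rewrite -sumEFin; apply: eq_bigr => c _.
under eq_integral do rewrite EFinM.
rewrite integralZl// integral_indic// EFinM fineK ?fin_num_measure//.
by rewrite setIC.
Qed.

(** The Radon-Nikodym density is approximated in L1 by a simple function. For the latter, the
    averages are finite combinations of averages of [lam] over level sets, and the error is at most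
    [K * e] for all [n] at once. *)
Lemma weighted_average_cvg_dominated (lam nu : {finite_measure set T -> \bar R})
    (H : R) : nu `<< lam ->
  (forall D, measurable D ->
    weighted_average lam n D @[n --> \oo] --> H * fine (lam D)) ->
  weighted_average nu n setT @[n --> \oo] --> H * fine (nu setT).
Proof.
move=> nulam cvlam.
pose f := Radon_Nikodym_SigmaFinite.f nu lam.
have intf : lam.-integrable setT f by exact: Radon_Nikodym_SigmaFinite.f_integrable.
have fE A : measurable A -> nu A = (\int[lam]_(x in A) f x)%E.
  exact: Radon_Nikodym_SigmaFinite.f_integral.
have [g [intg _ cvg_g]] := approximation_sfun_integrable measurableT intf.
have K0 : 0 <= K by have := aK 0; rewrite big_ord0.
apply: (@cvgn_approx _ _ _ (K + `|H|)) => e e0.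
have [k Hk] : exists k, (\int[lam]_x `|f x - (g k x)%:E| <= e%:E)%E.
  move/fine_cvgP : cvg_g => [[N1 _ fin] /cvgrPdist_le/(_ _ e0)[N2 _ Hk]].
  exists (maxn N1 N2).
  rewrite -(@fineK _ (\int[lam]_x _)%E); last by apply: fin; exact: leq_maxl.
  rewrite lee_fin; apply: le_trans (Hk (maxn N1 N2) (leq_maxr _ _)).
  by rewrite sub0r normrN ler_norm.
(* [s D] is the integral of the simple function [g k] over [D]. *)
pose s D := \sum_(c <- fset_set (range (g k))) c * fine (lam (D `&` g k @^-1` [set c])).
have close D : measurable D -> `|fine (nu D) - s D| <= e.
  move=> mD; rewrite -lee_fin -abse_EFin EFinB fineK ?fin_num_measure//.
  have intD : lam.-integrable D f by exact: integrableS intf.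
  have intgD : lam.-integrable D (EFin \o g k) by exact: integrableS (intg k).
  rewrite fE// -integral_sfun// -integralB//.
  have mfg : measurable_fun setT (fun x => f x - (g k x)%:E)%E.
    by apply: emeasurable_funB; [exact: measurable_int intf|exact: measurable_int (intg k)].
  apply: le_trans Hk; apply: le_trans.
    by apply: le_abse_integral => //; exact: measurable_funTS.
  by apply: ge0_subset_integral => //; exact: measurableT_comp.
exists (fun n => \sum_(j < n.+1) a j * s (E (n - j)%N)), (H * s setT); split.
- rewrite /s.
  have -> : (fun n : nat => \sum_(j < n.+1) a j *
     (\sum_(c <- fset_set (range (g k))) c * fine (lam (E (n - j)%N `&` g k @^-1` [set c])))) =
     (fun n => \sum_(c <- fset_set (range (g k))) c * weighted_average lam n (g k @^-1` [set c])).
    apply/funext => n; under eq_bigr do rewrite mulr_sumr.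
    rewrite exchange_big /=; apply: eq_bigr => c _.
    by rewrite mulr_sumr; apply: eq_bigr => j _; rewrite mulrCA.
  rewrite mulr_sumr; apply: cvg_big => [|c _]; first exact: add_continuous.
  rewrite setTI mulrCA; apply: cvgMr; apply: cvlam; exact: measurable_funPTI.
- move=> n; rewrite /weighted_average -sumrB.
  apply: (le_trans (ler_norm_sum _ _ _)).
  apply: (@le_trans _ _ (\sum_(j < n.+1) a j * e)).
    apply: ler_sum => j _; rewrite setIT -mulrBr normrM ger0_norm// ler_wpM2l//.
    exact: close.
  by rewrite -mulr_suml ler_wpM2r ?(ltW e0)// (le_trans (aK _))// lerDl.
- rewrite -mulrBr normrM ler_pM//; first by rewrite lerDr.
  exact: close.
Qed.

End weighted_averages.

(** * Series dominated by a geometric series, and the orbit of 1 *)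

Section geometric_domination.
Context {R : realType}.
Variables (b C : R).
Hypotheses (b_gt0 : 0 < b) (b1 : b < 1).
Let b0 : 0 <= b. Proof. exact: ltW. Qed.

Lemma series_geometric_dominated (u : R^nat) : (forall n, `|u n| <= C * b ^+ n) ->
  cvgn (series u) /\
  forall N, `|limn (series u) - series u N| <= C * (b ^+ N / (1 - b)).
Proof.
move=> uC; have bn : `|b| < 1 by rewrite ger0_norm.
have C0 : 0 <= C by have := uC 0; rewrite expr0 mulr1; apply: le_trans.
have cu : cvgn (series u).
  apply: normed_cvg; apply: (@series_le_cvg _ _ (geometric C b)) => [n|n|n|] //=.
    by rewrite mulr_ge0// exprn_ge0.
  exact: is_cvg_geometric_series.
split=> // N; apply/ler_addgt0Pr => e e0.
have /cvgrPdist_le/(_ _ e0)[M _ HM] := cu.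
have := HM (N + M)%N (leq_addl _ _) => {}HM.
have : `|series u (N + M)%N - series u N| <= C * (b ^+ N / (1 - b)).
  rewrite /series /= sub_series_geq ?leq_addr//.
  apply: (le_trans (ler_norm_sum _ _ _)).
  apply: (@le_trans _ _ (\sum_(N <= k < N + M) C * b ^+ k)); first exact: ler_sum.
  rewrite -mulr_sumr ler_wpM2l// geometric_partial_tail.
  by apply: geometric_le_lim => //; rewrite exprn_ge0.
have -> : limn (series u) - series u N =
  (limn (series u) - series u (N + M)%N) + (series u (N + M)%N - series u N) by ring.
by have := ler_normD (limn (series u) - series u (N + M)%N) (series u (N + M)%N - series u N); lra.
Qed.

(** Tannery's theorem: the tails past [N] are small uniformly in [k], which leaves finite sums. *)
Lemma series_dominated_cvg (u : nat -> R^nat) (v : R^nat) :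
  (forall k n, `|u k n| <= C * b ^+ n) -> (forall n, `|v n| <= C * b ^+ n) ->
  (forall n, u k n @[k --> \oo] --> v n) ->
  limn (series (u k)) @[k --> \oo] --> limn (series v).
Proof.
move=> uC vC uv; apply: (@cvgn_approx _ _ _ C) => e e0.
have b1' : 0 < 1 - b by rewrite subr_gt0.
have C0 : 0 <= C by have := vC 0; rewrite expr0 mulr1; apply: le_trans.
have e1 : 0 < e * (1 - b) by exact: mulr_gt0.
have bn : `|b| < 1 by rewrite ger0_norm.
have /cvgrPdist_le/(_ _ e1)[N _ /(_ N (leqnn _))] := cvg_geometric 1 bn.
rewrite /= mul1r sub0r normrN ger0_norm ?exprn_ge0// -ler_pdivrMr// => HN.
exists (fun k => series (u k) N), (series v N); split.
- rewrite /series /=; apply: cvg_big => [|i _]; [exact: add_continuous|exact: uv].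
- move=> k; have [_ /(_ N)] := series_geometric_dominated (uC k).
  by move=> /le_trans; apply; exact: ler_wpM2l.
- have [_ /(_ N)] := series_geometric_dominated vC.
  by move=> /le_trans; apply; exact: ler_wpM2l.
Qed.

End geometric_domination.

Section orbit_of_one.
Context {R : realType}.
Variable beta : R.
Hypothesis beta1 : 1 < beta.

(** The starting point 1 lies outside [[0, 1)]; the formula for the transformation still yields
    Parry's convention for the first iterate. *)
Definition orbit1 (n : nat) : R := iter n (beta_transformation beta) 1.

Lemma orbit1_ge0 n : 0 <= orbit1 n.
Proof. by case: n => [//|n]; have /andP[] := beta_transformation_itv beta (orbit1 n). Qed.

Lemma orbit1S_lt1 n : orbit1 n.+1 < 1.
Proof. by have /andP[] := beta_transformation_itv beta (orbit1 n). Qed.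

Lemma orbit1_le1 n : orbit1 n <= 1.
Proof. by case: n => [//|n]; rewrite ltW ?orbit1S_lt1. Qed.

Let b := beta^-1.
Let beta0 : 0 < beta. Proof. exact: lt_trans beta1. Qed.
Let b_gt0 : 0 < b. Proof. by rewrite invr_gt0. Qed.
Let b0 : 0 <= b. Proof. exact: ltW. Qed.
Let b1 : b < 1. Proof. by rewrite invf_lt1. Qed.
Let bb : b * beta = 1. Proof. by rewrite mulVf ?lt0r_neq0. Qed.

(** The terms of Parry's normalising constant. *)
Definition orbit_weight (n : nat) : R := b ^+ n * orbit1 n.

Lemma orbit_weight_ge0 n : 0 <= orbit_weight n.
Proof. by rewrite mulr_ge0 ?exprn_ge0 ?orbit1_ge0. Qed.

Lemma orbit_weight_le n : orbit_weight n <= b ^+ n.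
Proof. by rewrite ler_piMr ?exprn_ge0 ?orbit1_le1. Qed.

Variables (c : R) (L : nat -> R -> R).
Hypotheses (c01 : 0 <= c <= 1) (L0 : forall t, 0 <= t <= 1 -> L 0 t = Num.min t c)
  (LS : forall n t, 0 <= t <= 1 -> L n.+1 t =
    b * ((Num.floor (beta * t))%:~R * L n 1 + L n (beta_transformation beta t))).

Let C n t := \sum_(j < n.+1) orbit_weight j * L (n - j) t.
Let H := limn (series (fun n => b ^+ n * Num.min (orbit1 n) c)).

Lemma orbit_convolution1 n : C n 1 = series (fun n => b ^+ n * Num.min (orbit1 n) c) n.+1.
Proof.
rewrite /series /= big_mkord; elim: n => [|n IH].
  by rewrite /C !big_ord1 /orbit_weight /= !expr0 !mul1r L0// ler01 lexx.
rewrite big_ord_recr /= -IH.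
(* The recursion for [L] at the orbit point [x_i], whose floor is [beta * x_i - x_(i+1)], turns the
   increments of [F] into differences of consecutive weights times [L (n - i) 1]. *)
pose F i := b ^+ i * L (n.+1 - i) (orbit1 i).
have FS i : (i < n.+1)%N -> F i.+1 - F i =
    orbit_weight i.+1 * L (n - i) 1 - orbit_weight i * L (n - i) 1.
  move=> iln; rewrite /F subSS subSn// LS; last by rewrite orbit1_ge0 orbit1_le1.
  rewrite /orbit_weight /= -/(orbit1 i) {2}/beta_transformation exprS.
  set y := orbit1 i; set l := L _ _; set l' := L _ _; set k := _%:~R.
  have -> : b * b ^+ i * (beta * y - k) * l' = b ^+ i * ((b * beta) * y - b * k) * l' by ring.
  rewrite bb; ring.
have : \sum_(0 <= i < n.+1) (F i.+1 - F i) =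
   \sum_(0 <= i < n.+1) (orbit_weight i.+1 * L (n - i) 1 - orbit_weight i * L (n - i) 1).
  by rewrite !big_mkord; apply: eq_bigr => i _; exact: FS.
rewrite telescope_sumr// sumrB !big_mkord -/(C n 1) /F subnn subn0 expr0 mul1r /=.
rewrite L0; last by apply/andP; split; [exact: (orbit1_ge0 n.+1)|exact: (orbit1_le1 n.+1)].
move=> E.
rewrite {1}/C big_ord_recl /= /orbit_weight expr0 !mul1r subn0.
under eq_bigr do rewrite /bump /= add1n subSS.
rewrite (_ : \sum_(i < n.+1) _ = \sum_(i < n.+1) orbit_weight i.+1 * L (n - i) 1)//.
by move: E; lra.
Qed.

(** [C n.+1 t] and [t * H] obey the same recursion up to a geometrically small term. Hence the error
    at [t] is at most [b] times the error at [T t], plus the error at 1, which is the tail of a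
    series, plus that term. *)
Lemma orbit_convolution_cvg t : 0 <= t <= 1 -> C n t @[n --> \oo] --> t * H.
Proof.
pose q := (1 - b)^-1.
have := (b_gt0, b1, beta1) => -[[hb hb1] hbeta1]; move/andP: (c01) => [hc0 hc1].
have q0 : 0 < q by rewrite invr_gt0; lra.
have qE : q * (1 - b) = 1 by rewrite mulVf// lt0r_neq0//; lra.
have uC n : `|b ^+ n * Num.min (orbit1 n) c| <= 1 * b ^+ n.
  rewrite ger0_norm; last first.
    by rewrite mulr_ge0 ?exprn_ge0// le_min orbit1_ge0; case/andP: c01.
  by rewrite mul1r ler_piMr ?exprn_ge0// ge_min orbit1_le1.
have [_ tail] := series_geometric_dominated b_gt0 b1 uC.
have tail1 n : `|C n 1 - H| <= b ^+ n.+1 * q.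
  by rewrite orbit_convolution1 distrC; have := tail n.+1; rewrite mul1r.
have H0 : `|H| <= q.
  by have := tail 0; rewrite /series /= big_geq// subr0 expr0 !mul1r.
(* A ratio strictly between [b] and 1 absorbs the new errors of order [b ^+ n] at each step. The
   constant [M] is chosen so that [M * (r - b) = q + 1], which closes the induction exactly. *)
pose r := (1 + b) / 2; pose M := 2 * (q + 1) * q.
have rb n : b ^+ n <= r ^+ n by rewrite lerXn2r ?nnegrE /r//; lra.
have key n : forall t, 0 <= t <= 1 -> `|C n t - t * H| <= M * r ^+ n.
  elim: n => [|n IH] {}t t01.
    rewrite /C big_ord1 /orbit_weight expr0 /= !mul1r mulr1 L0//.
    have := ler_normB (Num.min t c) (t * H).
    have : `|t * H| <= q.
      by rewrite normrM ger0_norm; [apply: le_trans H0; apply: ler_piMl => //; lra|lra].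
    have : `|Num.min t c| <= 1.
      rewrite ger0_norm ?ge_min ?le_min; lra.
    have : 1 <= q by nra.
    rewrite /M; nra.
  have tt := beta_transformation_itv beta t.
  have CS : C n.+1 t = b * ((Num.floor (beta * t))%:~R * C n 1 + C n (beta_transformation beta t))
     + orbit_weight n.+1 * Num.min t c.
    rewrite {1}/C big_ord_recr /= subnn L0//; congr (_ + _).
    rewrite /C mulr_sumr -big_split /= mulr_sumr; apply: eq_bigr => i _.
    have il : (i <= n)%N by rewrite -ltnS.
    rewrite (subSn il) LS//; move: (orbit_weight i) (L (n - i)%N 1) (L (n - i)%N _) => w l l'.
    by rewrite mulrCA mulrDr (mulrCA w).
  have tE : t = b * ((Num.floor (beta * t))%:~R + beta_transformation beta t).
    by rewrite /beta_transformation addrC subrK mulrA bb mul1r.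
  have {}IH : `|C n (beta_transformation beta t) - beta_transformation beta t * H| <= M * r ^+ n.
    by apply: IH; lra.
  have fl : 0 <= ((Num.floor (beta * t))%:~R : R) <= beta.
    apply/andP; split; first by rewrite ler0z floor_ge0 mulr_ge0 ?(ltW beta0)//; lra.
    by apply: (le_trans (floor_le _)); rewrite ler_piMr ?(ltW beta0)//; lra.
  have -> : C n.+1 t - t * H = b * ((Num.floor (beta * t))%:~R * (C n 1 - H)) +
     b * (C n (beta_transformation beta t) - beta_transformation beta t * H) +
     orbit_weight n.+1 * Num.min t c.
    by rewrite CS [X in _ - X * H = _]tE; ring.
  set X := b * _; set Y := b * (C _ _ - _); set Z := orbit_weight _ * _.
  have hX : `|X| <= r ^+ n * q.
    move/andP: fl => [fl0 fl1].
    rewrite /X !normrM (ger0_norm b0) (ger0_norm fl0).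
    apply: (@le_trans _ _ (b * (beta * (b ^+ n.+1 * q)))).
      by rewrite ler_wpM2l// ler_pM.
    rewrite mulrA bb mul1r ler_wpM2r ?(ltW q0)// exprS.
    by apply: le_trans (rb n); rewrite ler_piMl ?exprn_ge0// (ltW b1).
  have hY : `|Y| <= b * (M * r ^+ n).
    by rewrite /Y normrM ger0_norm// ler_wpM2l.
  have hZ : `|Z| <= r ^+ n.
    rewrite /Z normrM ger0_norm ?orbit_weight_ge0//.
    rewrite -[leRHS]mulr1 ler_pM ?orbit_weight_ge0//.
      apply: (le_trans (orbit_weight_le _)); apply: le_trans (rb n).
      by rewrite exprS ler_piMl ?exprn_ge0// (ltW b1).
    rewrite ger0_norm ?ge_min ?le_min; lra.
  have := ler_normD (X + Y) Z; have := ler_normD X Y => h1 h2.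
  apply: (@le_trans _ _ (r ^+ n * q + b * (M * r ^+ n) + r ^+ n)); first lra.
  rewrite exprS; move: (r ^+ n) => p; rewrite /M /r.
  suff -> : 2 * (q + 1) * q * ((1 + b) / 2 * p) =
     p * q + b * (2 * (q + 1) * q * p) + p + (q + 1) * p * (q * (1 - b) - 1).
    by rewrite qE subrr mulr0 addr0.
  by field.
move=> t01; apply/cvgrPdist_le => e e0.
have rn : `|r| < 1 by rewrite ger0_norm /r; lra.
have /cvgrPdist_le/(_ _ e0) := cvg_geometric M rn.
apply: filterS => n /=; rewrite sub0r normrN distrC => h.
by apply: (le_trans (key n t t01)); apply: le_trans h; exact: ler_norm.
Qed.

End orbit_of_one.

(** * Parry's formula *)

Section renyi_parry.
Context {R : realType}.
Variables (beta : R) (nu : probability (measurableTypeR R) R).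
Hypotheses (beta1 : 1 < beta) (hnu : is_renyi_parry beta nu).

(** By invariance every [E n] has the [nu]-mass of [[0, c)], so the average for [nu] is a partial
    sum of the weights times this mass. Its limit is [H] by transfer from Lebesgue measure. *)
Lemma renyi_parry_cdf (c : R) : 0 <= c <= 1 ->
  limn (series (orbit_weight beta)) * fine (nu `[0, c[%classic) =
  limn (series (fun n => beta^-1 ^+ n * Num.min (orbit1 beta n) c)).
Proof.
move=> c01; have [nu1 nuT nulam _] := hnu.
set H := RHS.
have beta0 : 0 < beta by exact: lt_trans beta1.
have b_gt0 : 0 < beta^-1 by rewrite invr_gt0.
have b1 : beta^-1 < 1 by rewrite invf_lt1.
pose T := beta_transformation beta.
pose E n : set (measurableTypeR R) := @unit_itv R `&` iter n T @^-1` `[0, c[%classic.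
have Tunit y : @unit_itv R (T y) by rewrite /unit_itv /= in_itv /= beta_transformation_itv.
have E0 : E 0 = `[0, c[%classic.
  apply/seteqP; split => y /=; rewrite /E /unit_itv /= !in_itv /=; first by case.
  move=> /andP[? ?]; split; apply/andP; split; lra.
have ES n : E n.+1 = @unit_itv R `&` T @^-1` E n.
  apply/seteqP; split => y; rewrite /E /= -iterSr /=; first by move=> [? ?]; split.
  by move=> [? [? ?]].
have mE n : measurable (E n).
  elim: n => [|n IH]; first by rewrite E0; exact: measurable_itv.
  by rewrite ES; apply: measurable_beta_transformation => //; exact: measurable_unit_itv.
have Eunit n : E n `<=` @unit_itv R by move=> y [].
have nuE n : nu (E n) = nu `[0, c[%classic.
  by elim: n => [|n IH]; [rewrite E0|rewrite ES nuT].
pose L n t := fine (lebesgue_measure (E n `&` `[0, t[%classic)).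
have L0 t : 0 <= t <= 1 -> L 0 t = Num.min t c.
  move=> t01; rewrite /L E0.
  have -> : `[0, c[ `&` `[0, t[ = `[0, Num.min t c[%classic :> set R.
    by apply/seteqP; split => y /=; rewrite !in_itv /= lt_min; lra.
  rewrite lebesgue_measure_itv /= lte_fin; case: ifP => [_|/negbT]; first by rewrite oppr0 adde0.
  have : 0 <= Num.min t c by rewrite le_min; lra.
  by rewrite -leNgt => ? ?; apply/esym/le_anti/andP.
have finE (A : set (measurableTypeR R)) : measurable A -> A `<=` @unit_itv R ->
    lebesgue_measure A \is a fin_num.
  move=> mA A1; rewrite ge0_fin_numE//.
  apply: (@le_lt_trans _ _ (lebesgue_measure (@unit_itv R))).
    by apply: le_measure; rewrite ?inE//; exact: measurable_unit_itv.
  by rewrite lebesgue_measure_itv /= lte_fin ltr01 -EFinB ltey.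
have LS n t : 0 <= t <= 1 -> L n.+1 t =
    beta^-1 * ((Num.floor (beta * t))%:~R * L n 1 + L n (T t)).
  move=> /andP[t0 t1].
  have EE : E n.+1 `&` `[0, t[ = `[0, t[ `&` T @^-1` E n.
    rewrite ES; apply/seteqP; split => y; first by move=> [[? ?] ?].
    move=> [yt ?]; split => //; split => //; move: yt; rewrite /unit_itv /= !in_itv /=; lra.
  rewrite {1}/L EE (lebesgue_beta_transformation_preimage beta0 t0)//.
  have -> : L n 1 = fine (lebesgue_measure (E n)).
    by rewrite /L (_ : E n `&` _ = E n)//; apply/setIidl/Eunit.
  have fT : lebesgue_measure (E n `&` `[0, T t[) \is a fin_num.
    by apply: finE; [exact: measurableI|move=> y [/Eunit]].
  have fE : lebesgue_measure (E n) \is a fin_num by exact: finE.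
  by rewrite /L -(fineK fT) -(fineK fE).
have lam_fin : (lebesgue_measure (@unit_itv R) < +oo)%E.
  by rewrite lebesgue_measure_itv /= lte_fin ltr01 -EFinB ltey.
pose lam : {finite_measure set (measurableTypeR R) -> \bar R} :=
  mfrestr (@measurable_unit_itv R) lam_fin.
have lamE A : lam A = lebesgue_measure (A `&` @unit_itv R) by [].
pose K := limn (series (orbit_weight beta)).
have wC n : `|orbit_weight beta n| <= 1 * beta^-1 ^+ n.
  by rewrite mul1r ger0_norm ?orbit_weight_ge0 ?orbit_weight_le.
have [cK _] := series_geometric_dominated b_gt0 b1 wC.
have wK n : \sum_(j < n) orbit_weight beta j <= K.
  have -> : \sum_(j < n) orbit_weight beta j = series (orbit_weight beta) n.
    by rewrite /series /= big_mkord.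
  apply: nondecreasing_cvgn_le => //; apply/nondecreasing_seqP => k.
  by rewrite /series /= big_nat_recr//= lerDl orbit_weight_ge0.
have conv t (D : set R) : 0 <= t <= 1 -> D `&` @unit_itv R = `[0, t[%classic ->
    weighted_average (orbit_weight beta) E lam n D @[n --> \oo] --> H * fine (lam D).
  move=> t01 Dt.
  have -> : fine (lam D) = t.
    rewrite lamE Dt lebesgue_measure_itv /= lte_fin; case: ifP => [_|]; first by rewrite oppr0 adde0.
    by move=> /negbT; rewrite -leNgt => ? /=; lra.
  rewrite mulrC.
  have := orbit_convolution_cvg beta1 c01 L0 LS t01.
  suff -> : (fun n : nat => \sum_(j < n.+1) orbit_weight beta j * L (n - j)%N t) =
     (fun n => weighted_average (orbit_weight beta) E lam n D) by [].
  apply/funext => n; apply: eq_bigr => j _; congr (_ * _).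
  by rewrite /L lamE -Dt setIA.
have w0 n : 0 <= orbit_weight beta n by exact: orbit_weight_ge0.
have cvlam D : measurable D ->
    weighted_average (orbit_weight beta) E lam n D @[n --> \oo] --> H * fine (lam D).
  (* The generating half-lines []-oo, x[] meet [[0, 1)] in [[0, t)], with [t] the truncation of [x]
     to [[0, 1]], where the limit is known. *)
  apply: (weighted_average_cvg_measurable w0 wK mE (G := @RGenInftyO.G R)).
  - move=> _ _ [x ->] [y ->]; exists (Num.min x y).
    by apply/seteqP; split => z /=; rewrite !in_itv /= lt_min; [case=> -> ->|move=> /andP].
  - exact: RGenInftyO.measurableE.
  - move=> X [[x ->]|->].
      apply: (conv (Num.max 0 (Num.min x 1))).
        by rewrite le_max lexx /= ge_max ler01 ge_min lexx orbT.
      by apply/seteqP; split => z /=; rewrite /unit_itv /= !in_itv /= lt_max lt_min;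
        [move=> [? ?]|move=> ?; split]; lra.
    by apply: (conv 1); [rewrite ler01 lexx|rewrite setTI].
have := weighted_average_cvg_dominated (lam := lam) (nu := nu) w0 wK mE nulam cvlam.
have -> : (fun n => weighted_average (orbit_weight beta) E nu n setT) =
  (fun n => series (orbit_weight beta) n.+1 * fine (nu `[0, c[%classic)).
  apply/funext => n; rewrite /series /= big_mkord mulr_suml; apply: eq_bigr => j _.
  by rewrite setIT nuE.
rewrite [X in _ * X](_ : _ = 1) ?mulr1 => [cvH|]; last by rewrite [X in fine X]probability_setT.
apply: cvg_unique cvH => //; apply: cvgMl.
by rewrite (cvg_shiftS (series (orbit_weight beta))).
Qed.

End renyi_parry.

(** * Masses carried by the orbit of 1 *)

Lemma lim_series_finite_support (R : realType) (u : R^nat) (N : nat) :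
  (forall n, (N <= n)%N -> u n = 0) -> limn (series u) = series u N.
Proof.
move=> u0; apply/cvg_lim => //; apply: cvg_near_cst; exists N => // n /= Nn.
rewrite /series /= (big_cat_nat (leq0n N) Nn) /= [X in _ + X]big_nat_cond [X in _ + X]big1 ?addr0//.
by move=> i /andP[/andP[Ni _] _]; exact: u0.
Qed.

Section orbit_moment.
Context {R : realType}.
Variable beta : R.
Hypothesis beta1 : 1 < beta.

Let b := beta^-1.
Let beta0 : 0 < beta. Proof. exact: lt_trans beta1. Qed.
Let b_gt0 : 0 < b. Proof. by rewrite invr_gt0. Qed.
Let b0 : 0 <= b. Proof. exact: ltW. Qed.
Let b1 : b < 1. Proof. by rewrite invf_lt1. Qed.

Local Notation x := (orbit1 beta).

(** The integral of [phi] against the measure that puts mass [b ^+ n] at each [x n]. *)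
Definition orbit_moment (phi : R -> R) : R := limn (series (fun n => b ^+ n * phi (x n))).

Let dominated (phi : R -> R) C : (forall t, 0 <= t <= 1 -> `|phi t| <= C) ->
  forall n, `|b ^+ n * phi (x n)| <= C * b ^+ n.
Proof.
move=> H n; rewrite normrM ger0_norm ?exprn_ge0// mulrC ler_wpM2r ?exprn_ge0//.
by apply: H; rewrite orbit1_ge0 orbit1_le1.
Qed.

Lemma orbit_moment_cvg (phi : R -> R) C : (forall t, 0 <= t <= 1 -> `|phi t| <= C) ->
  series (fun n => b ^+ n * phi (x n)) @ \oo --> orbit_moment phi.
Proof. by move=> /dominated/(series_geometric_dominated b_gt0 b1)[]. Qed.

Lemma orbit_moment_linear (phi psi : R -> R) (r s : R) C :
  (forall t, 0 <= t <= 1 -> `|phi t| <= C) -> (forall t, 0 <= t <= 1 -> `|psi t| <= C) ->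
  orbit_moment (fun t => r * phi t + s * psi t) = r * orbit_moment phi + s * orbit_moment psi.
Proof.
move=> Hphi Hpsi; apply/cvg_lim => //.
rewrite (_ : series _ = (fun n => r * series (fun n => b ^+ n * phi (x n)) n +
                                s * series (fun n => b ^+ n * psi (x n)) n)).
  by apply: cvgD; apply: cvgMr; [exact: orbit_moment_cvg Hphi|exact: orbit_moment_cvg Hpsi].
apply/funext => n; rewrite /series /= !mulr_sumr -big_split /=.
by apply: eq_bigr => i _; ring.
Qed.

Lemma orbit_moment_dominated_cvg (phi : nat -> R -> R) (psi : R -> R) C :
  (forall k t, 0 <= t <= 1 -> `|phi k t| <= C) -> (forall t, 0 <= t <= 1 -> `|psi t| <= C) ->
  (forall t, 0 <= t <= 1 -> phi k t @[k --> \oo] --> psi t) ->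
  orbit_moment (phi k) @[k --> \oo] --> orbit_moment psi.
Proof.
move=> Hphi Hpsi cv; apply: (series_dominated_cvg b_gt0 b1 (C := C)).
- by move=> k; apply: dominated; exact: Hphi.
- exact: dominated.
- by move=> n /=; apply: cvgMr; apply: cv; rewrite orbit1_ge0 orbit1_le1.
Qed.

Lemma orbit_moment_ge (phi : R -> R) C n : (forall t, 0 <= t <= 1 -> 0 <= phi t <= C) ->
  b ^+ n * phi (x n) <= orbit_moment phi.
Proof.
move=> H; have Hphi t : 0 <= t <= 1 -> `|phi t| <= C.
  by move=> /H/andP[? ?]; rewrite ger0_norm.
have pos k : 0 <= b ^+ k * phi (x k).
  have /H/andP[h _] : 0 <= x k <= 1 by rewrite orbit1_ge0 orbit1_le1.
  by rewrite mulr_ge0 ?exprn_ge0.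
apply: (@le_trans _ _ (series (fun n => b ^+ n * phi (x n)) n.+1)).
  by rewrite /series /= big_nat_recr//= lerDr sumr_ge0.
apply: nondecreasing_cvgn_le; last by apply/cvgP; exact: orbit_moment_cvg Hphi.
by apply/nondecreasing_seqP => k; rewrite /series /= big_nat_recr//= lerDl.
Qed.

(** The orbit measure is the point mass at 1 plus [b] times its own image under the
    transformation. *)
Lemma orbit_moment_shift (phi : R -> R) C : (forall t, 0 <= t <= 1 -> `|phi t| <= C) ->
  orbit_moment phi = phi 1 + b * orbit_moment (phi \o beta_transformation beta).
Proof.
move=> H; apply/cvg_lim => //; rewrite -cvg_shiftS.
rewrite (_ : [sequence _]_n = fun n => phi 1 +
   b * series (fun n => b ^+ n * (phi \o beta_transformation beta) (x n)) n).
  apply: cvgD; first exact: cvg_cst.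
  apply: cvgMr; apply: (@orbit_moment_cvg _ C) => t t01; apply: H.
  by have := beta_transformation_itv beta t; lra.
apply/funext => n; rewrite /series /= big_nat_recl//= expr0 mul1r mulr_sumr; congr (_ + _).
by apply: eq_bigr => i _; rewrite exprS mulrA.
Qed.

Definition orbit_mass (y : R) : R := orbit_moment (fun t => (t == y)%:R).

Definition orbit_support_mass : R := orbit_moment (fun t => (t != 0)%:R).

Let bool01 (c : bool) : 0 <= (c%:R : R) <= 1.
Proof. by case: c; rewrite ?lexx ?ler01. Qed.

Let normb (c : bool) : `|c%:R : R| <= 1.
Proof. by case: c; rewrite ?normr1 ?normr0 ?ler01. Qed.

Lemma orbit_mass_ge n : b ^+ n <= orbit_mass (x n).
Proof.
have := @orbit_moment_ge (fun t => (t == x n)%:R) 1 n (fun t _ => bool01 _).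
by rewrite eqxx mulr1.
Qed.

Lemma orbit_mass_neq0 y : orbit_mass y != 0 -> exists n, x n = y.
Proof.
move=> y0; apply: contrapT => H; move/eqP: y0; apply.
rewrite /orbit_mass /orbit_moment (@lim_series_finite_support _ _ 0) ?/series/= ?big_geq// => n _.
by case: eqP => [xny|]; [case: H; exists n|rewrite mulr0].
Qed.

(** All later points are below 1, so the orbit visits 1 only at time 0. *)
Lemma orbit_mass1 : orbit_mass 1 = 1.
Proof.
rewrite /orbit_mass /orbit_moment (@lim_series_finite_support _ _ 1).
  by rewrite /series /= big_nat1 expr0 mul1r eqxx.
by case=> // n _; rewrite lt_eqF ?mulr0//; exact: orbit1S_lt1.
Qed.

Lemma beta_transformation0 : beta_transformation beta 0 = 0.
Proof. by rewrite /beta_transformation mulr0 floor0 subr0. Qed.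

Lemma orbit1_eq0_le m n : (m <= n)%N -> x m = 0 -> x n = 0.
Proof.
move=> /subnK <- xm; elim: (n - m)%N => [//|k IH].
by rewrite addSn /orbit1 /= -/(orbit1 beta (k + m)) IH beta_transformation0.
Qed.

Lemma orbit1_addn_eq i j m : x i = x j -> x (m + i) = x (m + j).
Proof. by move=> xij; rewrite /orbit1 !iterD -!/(orbit1 beta _) xij. Qed.

(** A repeated nonzero value would recur periodically, whereas 0 is fixed and absorbs the orbit from
    time [N] on. *)
Lemma orbit1_inj_of_eq0 N m n : x N = 0 -> x m = x n -> x m != 0 -> m = n.
Proof.
move=> xN; wlog mn : m n / (m <= n)%N.
  move=> W xmn xm; case/orP: (leq_total m n) => [mn|nm]; first exact: W.
  by apply/esym/W => //; rewrite -xmn.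
move=> xmn xm; apply/eqP; rewrite eqn_leq mn /= leqNgt; apply/negP => ltmn.
have per k : x (k * (n - m) + m)%N = x m.
  elim: k => [//|k IH]; rewrite mulSn addnAC subnK// addnC.
  by rewrite (orbit1_addn_eq _ (esym xmn)).
move/eqP: xm; apply; rewrite -(per N.+1); apply: orbit1_eq0_le xN; nia.
Qed.

Lemma orbit_mass_of_eq0 N n : x N = 0 -> x n != 0 -> orbit_mass (x n) = b ^+ n.
Proof.
move=> xN xn; rewrite /orbit_mass /orbit_moment (@lim_series_finite_support _ _ n.+1).
  rewrite /series /= big_nat_recr//= eqxx mulr1 big_nat_cond big1 ?add0r// => i.
  rewrite andbT => /andP[_ lin]; case: eqP => [xin|]; last by rewrite mulr0.
  by move: lin; rewrite (@orbit1_inj_of_eq0 N i n) ?ltnn// xin.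
move=> i ni; case: eqP => [xin|]; last by rewrite mulr0.
by move: ni; rewrite (@orbit1_inj_of_eq0 N i n) ?ltnn// xin.
Qed.

Lemma orbit_support_mass_neq0 : (forall n, x n != 0) -> orbit_support_mass = (1 - b)^-1.
Proof.
move=> xn; rewrite /orbit_support_mass /orbit_moment.
under eq_fun do rewrite xn mulr1.
rewrite exprn_geometric -[RHS]mul1r; apply/cvg_lim => //.
by apply: cvg_geometric_series; rewrite ger0_norm.
Qed.

Lemma orbit_support_mass_eq0 N : x N = 0 -> (forall n, (n < N)%N -> x n != 0) ->
  orbit_support_mass = (1 - b ^+ N) / (1 - b).
Proof.
move=> xN xn; rewrite /orbit_support_mass /orbit_moment (@lim_series_finite_support _ _ N).
  have := @geometric_seriesE R 1 b; rewrite lt_eqF// => /(_ isT)/(congr1 (@^~ N)) /=.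
  rewrite mul1r => <-; rewrite /series /= !big_mkord; apply: eq_bigr => i _.
  by rewrite xn// mulr1 mul1r.
by move=> n Nn; rewrite (orbit1_eq0_le Nn xN) eqxx mulr0.
Qed.

(** The shift identity for the indicator of [x n.+1]: the term at 1 vanishes, and along the orbit
    the pulled back indicator is that of [x n]. *)
Lemma orbit_mass_unique_preimage n :
  (forall i, x i.+1 = x n.+1 -> x i = x n) ->
  orbit_mass (x n.+1) = b * orbit_mass (x n).
Proof.
move=> uniq; rewrite /orbit_mass (@orbit_moment_shift _ 1)//.
rewrite gt_eqF ?orbit1S_lt1// add0r; congr (_ * _).
rewrite /orbit_moment; congr (limn (series _)); apply/funext => i /=; congr (_ * (nat_of_bool _)%:R).
apply/eqP/eqP => [|->//]; exact: uniq.
Qed.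

End orbit_moment.

(** * Two orbits with the same masses *)

Section same_mass.
Context {R : realType}.

(** From time [i.+1] on the orbit has period [j - i]. If [i < i'], both [x_i'] and [x_j'] lie in the
    periodic part, where equal images come from equal points. *)
Lemma orbit1_merge_le (beta : R) i j i' j' : (i < j)%N -> (i' < j')%N ->
  orbit1 beta i.+1 = orbit1 beta j.+1 -> orbit1 beta i'.+1 = orbit1 beta j'.+1 ->
  orbit1 beta i' <> orbit1 beta j' -> (i' <= i)%N.
Proof.
move=> ij ij' eij eij' neq; rewrite leqNgt; apply/negP => ii'.
have per k : (i < k)%N -> orbit1 beta (k + (j - i)) = orbit1 beta k.
  move=> ik; have -> : (k + (j - i) = (k - i.+1) + j.+1)%N by lia.
  by rewrite -(orbit1_addn_eq _ eij); congr orbit1; lia.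
apply: neq; rewrite -(per i')// -(per j'); last by lia.
have -> : (i' + (j - i) = (j - i).-1 + i'.+1)%N by lia.
have -> : (j' + (j - i) = (j - i).-1 + j'.+1)%N by lia.
exact: orbit1_addn_eq.
Qed.

(** The orbit has the shape of the letter rho: only the entrance of the cycle can have two
    predecessors on it. *)
Lemma orbit1_merge_unique (beta : R) i j i' j' :
  orbit1 beta i.+1 = orbit1 beta j.+1 -> orbit1 beta i'.+1 = orbit1 beta j'.+1 ->
  orbit1 beta i <> orbit1 beta j -> orbit1 beta i' <> orbit1 beta j' ->
  orbit1 beta i.+1 = orbit1 beta i'.+1.
Proof.
wlog ij : i j / (i < j)%N.
  move=> W e e' n n'; case: (ltngtP i j) => [ij|ji|ij]; first exact: W e e' n n'.
    by rewrite e; apply: W (esym e) e' _ n' => //; exact/nesym.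
  by case: n; rewrite ij.
wlog ij' : i' j' / (i' < j')%N.
  move=> W e e' n n'; case: (ltngtP i' j') => [ij'|ji'|ij']; first exact: W e e' n n'.
    by rewrite e'; apply: W e (esym e') n _ => //; exact/nesym.
  by case: n'; rewrite ij'.
move=> e e' n n'; congr (orbit1 beta _.+1); apply/eqP; rewrite eqn_leq.
by rewrite (orbit1_merge_le ij' ij e' e n) (orbit1_merge_le ij ij' e e' n').
Qed.

Lemma orbit1_neq0_gt0 (beta : R) n : orbit1 beta n != 0 -> 0 < orbit1 beta n <= 1.
Proof. by move=> n0; rewrite lt0r n0 orbit1_ge0 orbit1_le1. Qed.

(** One step multiplies a point by at most [beta]. This bounds an early point from below by a later
    one. *)
Lemma inv_beta_scale_orbit1 (beta : R) k n : 1 < beta ->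
  beta^-1 ^+ k * orbit1 beta (k + n) <= orbit1 beta n.
Proof.
move=> beta1; have beta0 : 0 < beta by lra.
have binv : beta^-1 * beta = 1 by rewrite mulVf// gt_eqF.
elim: k => [|k IH]; first by rewrite mul1r.
rewrite exprSr -mulrA addSn; apply: le_trans IH.
rewrite ler_wpM2l ?exprn_ge0 ?invr_ge0 ?(ltW beta0)//.
rewrite [orbit1 _ _.+1]/= /beta_transformation -/(orbit1 beta (k + n)).
rewrite mulrBr mulrA binv mul1r lerBlDr lerDl.
rewrite mulr_ge0 ?invr_ge0 ?(ltW beta0)// ler0z floor_ge0.
by rewrite mulr_ge0 ?(ltW beta0)// orbit1_ge0.
Qed.

(** [beta * x_n] is a positive integer, hence at least 1. *)
Lemma orbit1_before_zero (beta : R) n : 1 < beta ->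
  orbit1 beta n != 0 -> orbit1 beta n.+1 = 0 -> beta^-1 <= orbit1 beta n.
Proof.
move=> beta1 xn; have beta0 : 0 < beta by lra.
rewrite /orbit1 /= /beta_transformation -/(orbit1 beta n) => /eqP; rewrite subr_eq0 => /eqP e.
rewrite -div1r ler_pdivrMr// mulrC e -[1]/(1%:~R) ler_int -gtz0_ge1 -(ltr0z R) -e.
by rewrite mulr_gt0//; case/andP: (orbit1_neq0_gt0 xn).
Qed.

Section two_bases.
Variables beta gamma : R.
Hypotheses (beta1 : 1 < beta) (gamma1 : 1 < gamma).
Hypotheses (x1_neq0 : orbit1 beta 1 != 0)
  (hmass : forall y, 0 < y <= 1 -> orbit_mass beta y = orbit_mass gamma y)
  (hsupp : orbit_support_mass beta = orbit_support_mass gamma).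

Local Notation x := (orbit1 beta).
Local Notation y := (orbit1 gamma).
Let b := beta^-1.
Let g := gamma^-1.
Let b0 : 0 < b. Proof. by rewrite invr_gt0 (lt_trans _ beta1). Qed.
Let b1 : b < 1. Proof. by rewrite invf_lt1 // (lt_trans _ beta1). Qed.
Let g0 : 0 < g. Proof. by rewrite invr_gt0 (lt_trans _ gamma1). Qed.
Let g1 : g < 1. Proof. by rewrite invf_lt1 // (lt_trans _ gamma1). Qed.

Lemma orbit_masses_neq0_eq : (forall n, x n != 0) -> (forall n, y n != 0) -> beta = gamma.
Proof.
move=> xn yn; move: hsupp; rewrite !orbit_support_mass_neq0// => /invr_inj/addrI/oppr_inj.
exact: invr_inj.
Qed.

(** The positive mass of [y n] puts it on the orbit of [beta], which visits each nonzero point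
    once. *)
Let mass_in_orbit N n : x N = 0 -> y n != 0 ->
  exists2 k, x k = y n & orbit_mass gamma (y n) = b ^+ k.
Proof.
move=> xN yn; have := orbit1_neq0_gt0 yn => /hmass e.
have : orbit_mass beta (y n) != 0.
  by rewrite e gt_eqF// (lt_le_trans _ (orbit_mass_ge gamma1 n))// exprn_gt0.
move=> /orbit_mass_neq0[k xk]; exists k => //.
by rewrite -e -xk (orbit_mass_of_eq0 beta1 xN)// xk.
Qed.

(** The mass [g] of [y 1] is a power of [b], with positive exponent because [y 1 < 1 = x 0]. *)
Lemma orbit_masses_eq0_le N M : x N = 0 -> y M = 0 -> y 1 != 0 -> g <= b.
Proof.
move=> xN yM y1; have [k xk] := mass_in_orbit xN y1.
rewrite (orbit_mass_of_eq0 gamma1 yM y1) expr1 => gk; rewrite /g gk.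
case: k xk {gk} => [|k] xk; first by have := orbit1S_lt1 gamma 0; rewrite -xk ltxx.
by rewrite exprS ler_piMr ?(ltW b0)// exprn_ile1// ltW.
Qed.

Lemma orbit_masses_mixed N : x N = 0 -> (forall n, y n != 0) ->
  gamma = beta + 1 /\ x 2 = 0.
Proof.
move=> xN0 yn; have beta0 : 0 < beta by apply: lt_trans beta1.
have [M /eqP xM Mmin] : exists2 M, x M == 0 & forall n, (n < M)%N -> x n != 0.
  have ex : exists n, x n == 0 by exists N; rewrite xN0.
  case: (ex_minnP ex) => M xM H; exists M => // n nM; apply/negP => /H.
  by rewrite leqNgt nM.
have M2 : (1 < M)%N.
  case: M xM {Mmin} => [|[|//]]; first by move/eqP; rewrite oner_eq0.
  by move=> xM; move: x1_neq0; rewrite xM eqxx.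
have bM : 0 < b ^+ M by exact: exprn_gt0.
have E : (1 - b ^+ M) * (1 - g) = 1 - b.
  move: hsupp; rewrite (orbit_support_mass_eq0 beta1 xM Mmin) (orbit_support_mass_neq0 gamma1 yn) => e.
  have b1' : 1 - b != 0 by rewrite gt_eqF// subr_gt0.
  have g1' : 1 - g != 0 by rewrite gt_eqF// subr_gt0.
  rewrite -[1 - b ^+ M](divfK b1') e mulrAC mulVf ?mul1r//.
have bM1 : b ^+ M < 1 by rewrite exprn_ilt1// ?ltW// -lt0n; lia.
(* [E] gives [1 - b < 1 - g], since [1 - b ^+ M] lies strictly between 0 and 1. *)
have [gb gg0 bb0 gg1 bb1] : [/\ g < b, 0 < g, 0 < b, g < 1 & b < 1].
  by split => //; have := (g0, g1) => -[]; nra.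
have bpow k : b ^+ k <= 1 by rewrite exprn_ile1// ltW.
(* With a single predecessor, the mass [b ^+ k.+1] is [g] times the mass of that predecessor, itself
   a power of [b]. *)
have predecessor k : x k.+1 != 0 -> exists2 n, y n.+1 = x k.+1 &
   (forall i, y i.+1 = y n.+1 -> y i = y n) -> exists l, b ^+ k.+1 = g * b ^+ l.
  move=> xk; have e := hmass (orbit1_neq0_gt0 xk).
  rewrite (orbit_mass_of_eq0 beta1 xM xk) in e.
  have /orbit_mass_neq0[[|n] yk] : orbit_mass gamma (x k.+1) != 0.
      by rewrite -e expf_neq0// gt_eqF.
    by have := orbit1S_lt1 beta k; rewrite -yk ltxx.
  exists n => // /(orbit_mass_unique_preimage gamma1); rewrite yk -e => ->.
  by have [l _ ->] := mass_in_orbit xM (yn n); exists l.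
have merge k : x k.+1 != 0 -> (forall l, b ^+ k.+1 <> g * b ^+ l) ->
    exists n m, [/\ y n.+1 = x k.+1, y m.+1 = y n.+1 & y m <> y n].
  move=> xk H; have [n ynk Hn] := predecessor _ xk.
  suff [m [? ?]] : exists m, y m.+1 = y n.+1 /\ y m <> y n by exists n, m.
  apply: contrapT => Hm; have [|l] := Hn; last exact: H.
  by move=> i yi; apply: contrapT => yin; apply: Hm; exists i.
(* [x 1] has several predecessors on the orbit of [gamma]: otherwise [b = g * b ^+ l <= g], against
   [g < b]. *)
have [n [m [yn1 ymn ynm]]] : exists n m, [/\ y n.+1 = x 1, y m.+1 = y n.+1 & y m <> y n].
  apply: merge => // l; rewrite expr1 => bgl; have := bpow l; nra.
(* Once [x 2 = 0], the first zero is at [M = 2] and [E] reduces to [(1 + b) * (1 - g) = 1], that is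
   [gamma = beta + 1]. *)
suff x2 : x 2 = 0.
  split=> //; have M2' : M = 2%N.
    by apply/eqP; rewrite eqn_leq M2 andbT leqNgt; apply/negP => /Mmin; rewrite x2 eqxx.
  move: E; rewrite M2' => E; have {}E : (1 + b) * (1 - g) = 1.
    have : (1 - b) * ((1 + b) * (1 - g)) = (1 - b) * 1 by rewrite mulr1 -[RHS]E; ring.
    by apply: mulfI; rewrite gt_eqF// subr_gt0.
  have bE : b * beta = 1 by rewrite mulVf// gt_eqF.
  have gE : g * gamma = 1 by rewrite mulVf// gt_eqF// (lt_trans _ gamma1).
  have {}E : b = g * (1 + b) by move: E; lra.
  have : beta * gamma * b = beta * gamma * (g * (1 + b)) by rewrite -E.
  have -> : beta * gamma * b = (b * beta) * gamma by ring.
  have -> : beta * gamma * (g * (1 + b)) = (g * gamma) * (beta + b * beta) by ring.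
  by rewrite bE gE !mul1r.
apply/eqP; apply: contrapT => /negP x2.
(* As [g < b], the equation [b ^+ 2 = g * b ^+ l] forces [l = 0]. If it fails, [x 2] is a second
   merging point, hence equal to [x 1], although the orbit of [beta] has no nonzero repetition. *)
have gb2 : g = b ^+ 2.
  apply: contrapT => gb2.
  have [n' [m' [yn1' ymn' ynm']]] : exists n m, [/\ y n.+1 = x 2, y m.+1 = y n.+1 & y m <> y n].
    apply: merge => // -[|l]; first by rewrite expr0 mulr1 => /esym.
    rewrite expr2 exprS => bgl.
    have : g * (b * b ^+ l) <= g * b by rewrite ler_wpM2l ?ler_piMr ?bpow ?(ltW g0) ?(ltW b0).
    by rewrite -bgl; nra.
  have := orbit1_merge_unique ymn ymn' ynm ynm'; rewrite ymn yn1 ymn' yn1' => x12.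
  by have := orbit1_inj_of_eq0 beta1 xM x12 x1_neq0.
have M3 : (2 < M)%N.
  by rewrite ltn_neqAle M2 andbT; apply: contraNneq x2 => ->; rewrite xM.
have M12 : (2 <= M.-1)%N by lia.
(* The last nonzero point [x M.-1] is at least [b]; going back to [x 1] costs [M.-2] factors [b]. *)
have x1M : b ^+ M.-1 <= x 1.
  have -> : M.-1 = M.-2.+1 by lia.
  apply: le_trans (inv_beta_scale_orbit1 M.-2 1 beta1); rewrite exprSr ler_pM2l ?exprn_gt0//.
  by apply: orbit1_before_zero => //; [apply: Mmin; lia|rewrite -xM; congr (x _); lia].
have floor1 : 1 <= beta - x 1.
  rewrite /orbit1 /= /beta_transformation mulr1 opprB addrC subrK -[1]/(1%:~R) ler_int.
  by rewrite -gtz0_ge1 floor_gt0 ltW.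
have bE : b * beta = 1 by rewrite mulVf// gt_eqF.
have bMS : b ^+ M = b * b ^+ M.-1.
  by rewrite [in LHS](_ : M = M.-1.+1) ?exprS// prednK// ltnW.
have bM2 : b ^+ M.-1 <= b ^+ 2.
  by rewrite ler_wiXn2l ?(ltW b0) ?(ltW b1).
have E1 : 1 = b ^+ M.-1 * (1 + b).
  move: E; rewrite gb2 => E.
  have {}E : (1 - b ^+ M) * (1 + b) = 1.
    have : (1 - b) * ((1 - b ^+ M) * (1 + b)) = (1 - b) * 1 by rewrite mulr1 -[RHS]E; ring.
    by apply: mulfI; rewrite gt_eqF// subr_gt0.
  have : b * 1 = b * (b ^+ M.-1 * (1 + b)) by rewrite mulrA -bMS; move: E; lra.
  by apply: mulfI; rewrite gt_eqF.
(* With [s = b ^+ M.-1], the bounds [s <= x 1 <= beta - 1] and [s <= b ^+ 2] give [1 = s + s * b <=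
   b * (b + s) < b * (1 + s) <= 1]. *)
move: (b ^+ M.-1) x1M bM2 E1 {E bMS} => s x1M bM2 E1.
have : b * (1 + s) <= 1 by rewrite -bE ler_wpM2l ?(ltW b0)//; lra.
rewrite expr2 in bM2; nra.
Qed.

End two_bases.
End same_mass.

(** * Powers of a quadratic irrational *)

Section quadratic_powers.
Context {R : realType}.
Variables (beta : R) (p q : int).
Hypotheses (beta2 : beta ^+ 2 = q%:~R * beta + p%:~R).

(** Infinite descent: if [d * beta] is an integer, then [d * (beta - floor beta)] is a smaller
    positive integer with the same property, because [beta] is a root of a monic integer
    quadratic. *)
Lemma quadratic_irrational (u v : int) : beta \isn't a Num.int ->
  u%:~R * beta + v%:~R = 0 -> u = 0.
Proof.
move=> nint uv.
have [//|u0] := eqVneq u 0.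
suff D (d : nat) : (0 < d)%N -> (exists w : int, d%:R * beta = w%:~R) -> False.
  case: (D `|u|%N); first by rewrite absz_gt0.
  case: (intP u) u0 uv => [|n|n] // _; rewrite ?NegzE ?intrN -pmulrn => e.
    by exists (- v); rewrite rmorphN /=; lra.
  by exists v; rewrite abszN /=; lra.
elim/ltn_ind: d => d IH d0 [w dw].
pose f := Num.floor beta.
have fr0 : 0 < beta - f%:~R.
  rewrite subr_gt0 lt_neqAle floor_le andbT; apply: contraNneq nint => <-.
  exact: intr_int.
have fr1 : beta - f%:~R < 1 by have := floor_itv beta; rewrite intrD -/f; lra.
have d0' : 0 < d%:R :> R by rewrite ltr0n.
have e : (w - d%:Z * f)%:~R = d%:R * (beta - f%:~R) :> R.
  by rewrite rmorphB rmorphM /= -pmulrn -dw mulrBr.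
have n0 : 0 < w - d%:Z * f by rewrite -(ltr0z R) e mulr_gt0.
have nE : (`|(w - d%:Z * f)%R|%N)%:R = d%:R * (beta - f%:~R) :> R.
  by rewrite -e pmulrn gez0_abs// ltW.
apply: (IH `|(w - d%:Z * f)%R|%N); last first.
- exists (q * w + p * d%:Z - f * w); rewrite nE.
  rewrite !(rmorphD, rmorphN, rmorphM) /= -!pmulrn -dw.
  have -> : d%:R * (beta - f%:~R) * beta = d%:R * beta ^+ 2 - f%:~R * (d%:R * beta) by ring.
  by rewrite beta2; ring.
- by rewrite absz_gt0 gt_eqF.
- by rewrite -(ltr_nat R) nE gtr_pMr.
Qed.

Lemma quadratic_coefficients_eq (u v u' v' : int) : beta \isn't a Num.int ->
  u%:~R * beta + v%:~R = u'%:~R * beta + v'%:~R :> R -> u = u' /\ v = v'.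
Proof.
move=> nint e; have uu : u = u'.
  apply/eqP; rewrite -subr_eq0; apply/eqP.
  by apply: (@quadratic_irrational (u - u') (v - v')) => //; rewrite !rmorphB /=; lra.
split=> //; move: e; rewrite uu => /addrI; exact: intr_inj.
Qed.

Lemma quadratic_pow n : exists u v : int, beta ^+ n = u%:~R * beta + v%:~R.
Proof.
elim: n => [|n [u [v e]]]; first by exists 0, 1; rewrite mul0r add0r.
exists (u * q + v), (u * p); rewrite exprSr e !(rmorphD, rmorphM) /=.
have -> : (u%:~R * beta + v%:~R) * beta = u%:~R * beta ^+ 2 + v%:~R * beta by ring.
by rewrite beta2; ring.
Qed.

(** Sending [beta] to 0 modulo [p] sends [beta + 1] to 1, so the constant coefficient stays
    congruent to 1. *)
Lemma quadratic_succ_pow n : exists u s : int,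
  (beta + 1) ^+ n = u%:~R * beta + (1 + p * s)%:~R.
Proof.
elim: n => [|n [u [s e]]]; first by exists 0, 0; rewrite mul0r add0r mulr0 addr0.
exists (u * q + u + (1 + p * s)), (s + u); rewrite exprSr e !(rmorphD, rmorphM) /=.
have -> (a c : R) : (a * beta + c) * (beta + 1) = a * beta ^+ 2 + (a + c) * beta + c by ring.
by rewrite beta2; ring.
Qed.

(* The constant coefficient modulo [p] is the image under the ring morphism
   [Z[beta] -> Z/p] sending [beta] to [0]. *)
Lemma quadratic_pow_eq_dvd_constant m n : beta \isn't a Num.int -> (0 < m)%N ->
  beta ^+ m = (beta + 1) ^+ n -> (p %| 1)%Z.
Proof.
move=> nint; case: m => [//|m] _.
have [u [v e]] := quadratic_pow m; have [u' [s e']] := quadratic_succ_pow n.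
rewrite exprSr e e'.
have -> : (u%:~R * beta + v%:~R) * beta = (u * q + v)%:~R * beta + (p * u)%:~R.
  have -> (a c : R) : (a * beta + c) * beta = a * beta ^+ 2 + c * beta by ring.
  by rewrite beta2 !(rmorphD, rmorphM) /=; ring.
move=> /(quadratic_coefficients_eq nint)[_ h].
apply/dvdzP; exists (u - s); lia.
Qed.

(* Same idea with the ring morphism [Z[beta] -> Z/q] sending [beta] to [-1],
   which exists because [p = 1]. *)
Lemma quadratic_pow_eq_dvd_linear m n : p = 1 -> beta \isn't a Num.int -> (0 < n)%N ->
  beta ^+ m = (beta + 1) ^+ n -> (q %| 1)%Z.
Proof.
move=> p1 nint; case: n => [//|n] _.
(* The morphism sends [u * beta + v] to [v - u], which is written here as [(-1) ^+ m + q * t]. *)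
have [u [t e]] : exists u t : int, beta ^+ m = u%:~R * beta + (u + (-1) ^+ m + q * t)%:~R.
  elim: m => [|m [u [t e]]].
    by exists 0, 0; rewrite expr0 mul0r mulr0 !add0r addr0.
  exists (u * q + (u + (-1) ^+ m + q * t)), (- u - t).
  rewrite exprSr e.
  have -> (a c : R) : (a * beta + c) * beta = a * beta ^+ 2 + c * beta by ring.
  rewrite beta2 p1 exprS.
  rewrite !(rmorphD, rmorphN, rmorphM, rmorphXn) /=; ring.
have [u' [s e']] := quadratic_succ_pow n.
rewrite e exprSr e'.
(* The factor [beta + 1] is sent to 0: the two coefficients differ by [u' * q]. *)
have -> : (u'%:~R * beta + (1 + p * s)%:~R) * (beta + 1) =
    (u' * q + u' + (1 + p * s))%:~R * beta + (u' + (1 + p * s))%:~R.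
  have -> (a c : R) : (a * beta + c) * (beta + 1) = a * beta ^+ 2 + (a + c) * beta + c by ring.
  by rewrite beta2 p1 !(rmorphD, rmorphM) /=; ring.
move=> /(quadratic_coefficients_eq nint)[h h'].
have h2 : (-1) ^+ m = q * (- u' - t) by lia.
have : (q %| (-1) ^+ m)%Z by apply/dvdzP; exists (- u' - t); rewrite h2 mulrC.
by rewrite -signr_odd; case: (odd m) => //=; rewrite expr1 dvdzN.
Qed.

End quadratic_powers.

Lemma rational_ln_ratio_pow (R : realType) (s t : R) : 1 < s -> 1 < t ->
  rational (ln s / ln t) -> exists m n, [/\ (0 < m)%N, (0 < n)%N & s ^+ m = t ^+ n].
Proof.
move=> s1 t1 /rationalP[a [b e]].
have ls : 0 < ln s by rewrite ln_gt0.
have lt : 0 < ln t by rewrite ln_gt0.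
have r0 : 0 < a%:~R / b%:R :> R by rewrite -e divr_gt0.
have b0 : (0 < b)%N.
  by rewrite lt0n; apply: contraTneq r0 => ->; rewrite invr0 mulr0 ltxx.
have b0' : 0 < b%:R :> R by rewrite ltr0n.
have a0 : 0 < a by move: r0; rewrite pmulr_lgt0 ?invr_gt0// ltr0z.
case: a a0 e {r0} => // a a0 e; exists b, a; split => //.
have s0 : 0 < s by lra.
have t0 : 0 < t by lra.
apply: ln_inj; rewrite ?posrE ?exprn_gt0// !lnXn//.
move: e => /eqP; rewrite eqr_div ?(lt0r_neq0 lt) ?(lt0r_neq0 b0')// => /eqP.
rewrite -pmulrn -[ln s *+ b]mulr_natr -[ln t *+ a]mulr_natl.
exact.
Qed.

(** * Equal measures have equal masses *)

Section same_measure.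
Context {R : realType}.
Variables (beta1 beta2 : R) (nu1 nu2 : probability (measurableTypeR R) R).
Hypotheses (b1_gt1 : 1 < beta1) (b2_gt1 : 1 < beta2).
Hypotheses (hnu1 : is_renyi_parry beta1 nu1) (hnu2 : is_renyi_parry beta2 nu2)
  (hnu : eq_borel_measure nu1 nu2).

Let K1 := limn (series (orbit_weight beta1)).
Let K2 := limn (series (orbit_weight beta2)).

(** Agreement of the two orbit measures on [phi] after normalisation, cross-multiplied so that no
    division by [K1] or [K2] occurs. *)
Let test (phi : R -> R) := (exists C, forall t, 0 <= t <= 1 -> `|phi t| <= C) /\
  K2 * orbit_moment beta1 phi = K1 * orbit_moment beta2 phi.

(** For [c <= 1] this is Parry's formula. For [c > 1], which occurs in tents around points near 1,
    both moments are the normalising constants themselves. *)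
Let test_min c : 0 <= c -> test (fun t => Num.min t c).
Proof.
move=> c0; split.
  exists 1 => t t01; rewrite ger0_norm ?ge_min ?le_min; lra.
have [c1|c1] := leP c 1.
  have c01 : 0 <= c <= 1 by rewrite c0 c1.
  have e1 : orbit_moment beta1 (fun t => Num.min t c) = K1 * fine (nu1 `[0, c[%classic).
    exact/esym/(renyi_parry_cdf b1_gt1 hnu1 c01).
  have e2 : orbit_moment beta2 (fun t => Num.min t c) = K2 * fine (nu2 `[0, c[%classic).
    exact/esym/(renyi_parry_cdf b2_gt1 hnu2 c01).
  have e12 : nu1 `[0, c[%classic = nu2 `[0, c[%classic by apply: hnu; exact: measurable_itv.
  by rewrite e1 e2 e12 mulrCA.
have minE (beta : R) : orbit_moment beta (fun t => Num.min t c) = limn (series (orbit_weight beta)).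
  congr (limn (series _)); apply/funext => n; congr (_ * _).
  by apply/min_idPl; apply: (le_trans (orbit1_le1 _ _)); exact: ltW.
by rewrite !minE mulrC.
Qed.

Let test_linear phi psi r s : test phi -> test psi ->
  test (fun t => r * phi t + s * psi t).
Proof.
move=> [[C HC] e] [[D HD] e']; split.
  exists (`|r| * C + `|s| * D) => t t01; apply: (le_trans (ler_normD _ _)).
  by rewrite !normrM lerD// ler_wpM2l// ?HC ?HD.
have HC' t : 0 <= t <= 1 -> `|phi t| <= Num.max C D by move=> /HC h; rewrite le_max h.
have HD' t : 0 <= t <= 1 -> `|psi t| <= Num.max C D by move=> /HD h; rewrite le_max h orbT.
rewrite (orbit_moment_linear b1_gt1 r s HC' HD') (orbit_moment_linear b2_gt1 r s HC' HD').
by rewrite !mulrDr !(mulrCA _ r) !(mulrCA _ s) e e'.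
Qed.

Let test_cvg (phi : nat -> R -> R) psi : (forall k, test (phi k)) ->
  (forall k t, 0 <= t <= 1 -> 0 <= phi k t <= 1) ->
  (forall t, 0 <= t <= 1 -> `|psi t| <= 1) ->
  (forall t, 0 <= t <= 1 -> phi k t @[k --> \oo] --> psi t) ->
  K2 * orbit_moment beta1 psi = K1 * orbit_moment beta2 psi.
Proof.
move=> tphi phi1 psi1 cv.
have phi1' k t : 0 <= t <= 1 -> `|phi k t| <= 1.
  by move=> /(phi1 k)/andP[? ?]; rewrite ger0_norm.
have c1 := orbit_moment_dominated_cvg b1_gt1 phi1' psi1 cv.
have c2 := orbit_moment_dominated_cvg b2_gt1 phi1' psi1 cv.
apply: (@cvg_unique _ _ (K2 * orbit_moment beta1 (phi k) @[k --> \oo])) => //.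
  exact: cvgMr.
rewrite (_ : (fun k => _) = fun k => K1 * orbit_moment beta2 (phi k)); first exact: cvgMr.
by apply/funext => k; have [_] := tphi k.
Qed.

Let eps k : R := k.+1%:R^-1.
Let eps_gt0 k : 0 < eps k. Proof. by rewrite invr_gt0. Qed.
Let eps_le1 k : eps k <= 1. Proof. by rewrite invf_le1// ler1n. Qed.
Let eps_lt e : 0 < e -> \forall k \near \oo, eps k < e.
Proof.
move=> e0; have /cvgrPdist_lt/(_ _ e0) := @cvg_harmonic R.
by apply: filterS => k; rewrite sub0r normrN ger0_norm ?ltW ?eps_gt0.
Qed.

Let normb (c : bool) : `|c%:R : R| <= 1.
Proof. by case: c; rewrite ?normr1 ?normr0 ?ler01. Qed.

Let support_mass_eq : K2 * orbit_support_mass beta1 = K1 * orbit_support_mass beta2.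
Proof.
(* The functions [min t e / e] tend to the indicator of [t != 0] as [e] tends to 0; the null summand
   only gives them the form of [test_linear]. *)
apply: (test_cvg (phi := fun k t => (eps k)^-1 * Num.min t (eps k) + 0 * Num.min t 0)).
- by move=> k; exact: (test_linear _ _ (test_min (ltW (eps_gt0 k))) (test_min (lexx 0))).
- move=> k t t01; have e0 := eps_gt0 k; rewrite mul0r addr0 mulrC.
  rewrite divr_ge0 ?le_min ?(ltW e0)//; last by case/andP: t01 => ->.
  by rewrite ler_pdivrMr// mul1r ge_min lexx orbT.
- by move=> t _; exact: normb.
- move=> t t01; have [->|t0] := eqVneq t 0.
    rewrite (_ : (fun k => _) = cst 0); first exact: cvg_cst.
    by apply/funext => k; rewrite min_l ?(ltW (eps_gt0 k))// mulr0 mul0r addr0.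
  have {}t0 : 0 < t by rewrite lt0r t0; case/andP: t01.
  apply: cvg_near_cst; have := eps_lt t0; apply: filterS => k kt.
  by rewrite mul0r addr0 min_r ?(ltW kt)// mulVf// gt_eqF.
Qed.

(* The second difference of [min t _] at [y] is a tent of width [e] around [y]. *)
Let mass_eq y : 0 < y <= 1 -> K2 * orbit_mass beta1 y = K1 * orbit_mass beta2 y.
Proof.
(* Scaling by [y] keeps [y - e k] nonnegative, as [test_min] requires. *)
move=> /andP[y0 y1]; pose e k := y * eps k.
have e0 k : 0 < e k by rewrite mulr_gt0.
have ey k : e k <= y by rewrite ler_piMr ?(ltW y0).
pose tent k t := 2 * Num.min t y - Num.min t (y - e k) - Num.min t (y + e k).
apply: (test_cvg (phi := fun k t =>
  1 * ((2 * (e k)^-1) * Num.min t y + (- (e k)^-1) * Num.min t (y - e k)) +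
  (- (e k)^-1) * Num.min t (y + e k))).
- move=> k; have h1 : 0 <= y - e k by rewrite subr_ge0.
  have h2 : 0 <= y + e k by rewrite addr_ge0 ?ltW.
  exact: (test_linear _ _ (test_linear _ _ (test_min (ltW y0)) (test_min h1)) (test_min h2)).
- move=> k t t01; have ek := e0 k.
  rewrite (_ : _ + _ = tent k t / e k); last by rewrite /tent; ring.
  rewrite ler_pdivlMr// ler_pdivrMr// mul0r mul1r /tent.
  by case: (leP t y); case: (leP t (y - e k)); case: (leP t (y + e k)); lra.
- by move=> t _; exact: normb.
move=> t t01; rewrite (_ : (fun k => _) = fun k => tent k t / e k); last first.
  by apply/funext => k; rewrite /tent; ring.
have [->|ty] := eqVneq t y.
  rewrite (_ : (fun k => _) = cst 1); first exact: cvg_cst.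
  apply/funext => k; rewrite /tent /cst /= minxx min_r ?min_l; [|have := e0 k; lra..].
  by rewrite (_ : _ - _ = e k) ?divff ?gt_eqF//; ring.
apply: cvg_near_cst.
have d0 : 0 < `|t - y| by rewrite normr_gt0 subr_eq0.
have := eps_lt d0; apply: filterS => k kt.
have ek := e0 k; have eeps : e k <= eps k by rewrite ler_piMl ?(ltW (eps_gt0 k)).
suff -> : tent k t = 0 by rewrite mul0r.
rewrite /tent; move: kt; case: (ger0P (t - y)) => ?;
by case: (leP t y); case: (leP t (y - e k)); case: (leP t (y + e k)); lra.
Qed.

(** The point 1 has mass 1 for both bases, which forces [K1 = K2]; the common factor is at least its
    first term, 1, and cancels. *)
Lemma renyi_parry_same_mass :
  (forall y, 0 < y <= 1 -> orbit_mass beta1 y = orbit_mass beta2 y) /\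
  orbit_support_mass beta1 = orbit_support_mass beta2.
Proof.
have KK : K2 = K1 by have := mass_eq (y := 1); rewrite ltr01 lexx !orbit_mass1// !mulr1; apply.
have K0 : K2 != 0.
  have := @orbit_moment_ge _ beta2 b2_gt1 id 1 0 (fun t => id).
  by rewrite expr0 mul1r -/K2 => /(lt_le_trans ltr01) h; rewrite gt_eqF.
split=> [y /mass_eq|]; first by rewrite -KK => /(mulfI K0).
by have := support_mass_eq; rewrite -KK => /(mulfI K0).
Qed.

End same_measure.

(** * The golden ratio *)

Lemma orbit1_1_neq0 (R : realType) (beta : R) : beta \isn't a Num.int -> orbit1 beta 1 != 0.
Proof.
apply: contraNneq; rewrite /orbit1 /= /beta_transformation mulr1 => /eqP.
by rewrite subr_eq0 => /eqP ->; exact: intr_int.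
Qed.

(** Since [x 2 = 0], the first two digits [q] and [p] of the expansion of 1 in base [beta] are the
    coefficients of a quadratic equation for [beta]. The power relation makes both equal to 1. *)
Lemma mixed_orbits_golden_ratio (R : realType) (beta gamma : R) (N m n : nat) :
  1 < beta -> 1 < gamma -> beta \isn't a Num.int ->
  (forall y, 0 < y <= 1 -> orbit_mass beta y = orbit_mass gamma y) ->
  orbit_support_mass beta = orbit_support_mass gamma ->
  orbit1 beta N = 0 -> (forall k, orbit1 gamma k != 0) ->
  (0 < m)%N -> (0 < n)%N -> beta ^+ m = gamma ^+ n ->
  beta = (1 + Num.sqrt 5) / 2 /\ gamma = beta ^+ 2.
Proof.
move=> beta1 gamma1 nint hmass hsupp xN yn m0 n0 pow.
have x1 := orbit1_1_neq0 nint.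
have [gE x2] := orbit_masses_mixed beta1 gamma1 x1 hmass hsupp xN yn.
pose q := Num.floor beta; pose p := Num.floor (beta * orbit1 beta 1).
have x1E : orbit1 beta 1 = beta - q%:~R by rewrite /orbit1 /= /beta_transformation mulr1.
have pE : beta * orbit1 beta 1 = p%:~R.
  by apply/eqP; rewrite -subr_eq0; apply/eqP; exact: x2.
have beta2 : beta ^+ 2 = q%:~R * beta + p%:~R by rewrite -pE x1E; ring.
have p0 : 0 < p.
  rewrite -(ltr0z R) -pE; case/andP: (orbit1_neq0_gt0 x1) => h _.
  by rewrite mulr_gt0//; lra.
have q0 : 0 < q by rewrite floor_gt0 ltW.
rewrite gE in pow.
have one (r : int) : 0 < r -> (r %| 1)%Z -> r = 1.
  by case: r => // -[|[|r]]//.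
have p1 : p = 1 by apply: one => //; exact: (quadratic_pow_eq_dvd_constant beta2 nint m0 pow).
have q1 : q = 1 by apply: one => //; exact: (quadratic_pow_eq_dvd_linear beta2 p1 nint n0 pow).
have {}beta2 : beta ^+ 2 = beta + 1 by rewrite beta2 p1 q1 mul1r.
split; last by rewrite gE.
have -> : 5 = (2 * beta - 1) ^+ 2 :> R.
  have -> : (2 * beta - 1) ^+ 2 = 4 * beta ^+ 2 - 4 * beta + 1 by ring.
  by rewrite beta2; ring.
rewrite sqrtr_sqr ger0_norm; last by lra.
by field.
Qed.

Theorem corollary1p3 (R : realType) (beta1 beta2 : R)
    (nu1 nu2 : probability (measurableTypeR R) R)
    (hbeta1 : 1 < beta1) (hbeta2 : 1 < beta2)
    (nint1 : beta1 \isn't a Num.int) (nint2 : beta2 \isn't a Num.int)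
    (hneq : beta1 <> beta2)
    (hnu1 : is_renyi_parry beta1 nu1) (hnu2 : is_renyi_parry beta2 nu2)
    (hnu : eq_borel_measure nu1 nu2)
    (hlog : rational (ln beta1 / ln beta2)) :
  [set beta1; beta2] =
  [set (1 + Num.sqrt 5) / 2; ((1 + Num.sqrt 5) / 2) ^+ 2].
Proof.
have [m [n [m0 n0 pow]]] := rational_ln_ratio_pow hbeta1 hbeta2 hlog.
have [hmass hsupp] := renyi_parry_same_mass hbeta1 hbeta2 hnu1 hnu2 hnu.
have hmass' y : 0 < y <= 1 -> orbit_mass beta2 y = orbit_mass beta1 y by move=> /hmass.
have x1 := orbit1_1_neq0 nint1; have y1 := orbit1_1_neq0 nint2.
have hits (beta : R) : (exists N, orbit1 beta N = 0) \/ (forall k, orbit1 beta k != 0).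
  have [|H] := pselect (exists N, orbit1 beta N = 0); first by left.
  by right=> k; apply/eqP => xk; apply: H; exists k.
case: (hits beta1) (hits beta2) => [[N xN]|xn] [[M yM]|yn].
(* When both orbits reach 0, exchanging the roles of the bases gives both inequalities between the
   inverses. *)
- have le12 := orbit_masses_eq0_le hbeta2 hbeta1 hmass' yM xN x1.
  have le21 := orbit_masses_eq0_le hbeta1 hbeta2 hmass xN yM y1.
  by exfalso; apply: hneq; apply: invr_inj; apply/eqP; rewrite eq_le le12 le21.
- have [<- ->] // := mixed_orbits_golden_ratio hbeta1 hbeta2 nint1 hmass hsupp xN yn m0 n0 pow.
- rewrite setUC.
  have [<- ->] // := mixed_orbits_golden_ratio hbeta2 hbeta1 nint2 hmass' (esym hsupp) yM xn n0 m0 (esym pow).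
- by exfalso; apply: hneq; exact: orbit_masses_neq0_eq hbeta1 hbeta2 hsupp xn yn.
Qed.
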